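(* Let $\mathcal{H}$ be a complex separable Hilbert space and let $T\in\mathcal{B}(\mathcal{H})$ be a power-bounded operator. The following conditions are equivalent: (i) for every bounded backward sequence $\{x_n\}_{n\in\mathbb{N}}$ of $T$, the sequence of norms $\{\|x_n\|\}_{n\in\mathbb{N}}$ is constant; (ii) there is an orthogonal decomposition $\mathcal{H}=\mathcal{H}_1\oplus\mathcal{H}_2$ into closed subspaces with respect to which $T$ has the matrix form $$T=\begin{bmatrix} T_{11} & 0\\ T_{21} & U\end{bmatrix},$$ where $U\in\mathcal{B}(\mathcal{H}_2)$ is unitary, $T_{11}\in\mathcal{B}(\mathcal{H}_1)$ is of class $C_{\cdot 0}$, and $T_{21}\in\mathcal{B}(\mathcal{H}_1,\mathcal{H}_2)$.
   Context: $\mathcal{B}(\mathcal{H})$ is the space of bounded linear operators on $\mathcal{H}$, and $\mathcal{B}(\mathcal{H}_1,\mathcal{H}_2)$ the space of bounded linear operators from $\mathcal{H}_1$ to $\mathcal{H}_2$. An operator $T\in\mathcal{B}(\mathcal{H})$ is power-bounded if $\sup_{n\ge 1}\|T^n\|<\infty$. A bounded backward sequence of $T$ is a bounded sequence $\{x_n\}_{n\in\mathbb{N}}\subset\mathcal{H}$ ($\mathbb{N}=\{0,1,2,\dots\}$) with $Tx_{n+1}=x_n$ for all $n\in\mathbb{N}$. An operator $A$ on a Hilbert space $\mathcal{G}$ is of class $C_{0\cdot}$ if $\liminf_{n\to\infty}\|A^n x\|=0$ for every $x\in\mathcal{G}$; it is of class $C_{\cdot 0}$ if its adjoint $A^*$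 is of class $C_{0\cdot}$. Either of the subspaces $\mathcal{H}_1,\mathcal{H}_2$ is allowed to be $\{0\}$. The matrix form means $T(a+b)=T_{11}a+(T_{21}a+Ub)$ for $a\in\mathcal{H}_1$, $b\in\mathcal{H}_2$. *)

(* Defs.v *)
From HB Require Import structures.
From mathcomp Require Import all_boot all_order all_algebra.
From mathcomp Require Import complex.
From mathcomp Require Import all_classical all_reals all_analysis.

Set Implicit Arguments.
Unset Strict Implicit.
Unset Printing Implicit Defensive.

Import Order.TTheory GRing.Theory Num.Theory.
Import numFieldNormedType.Exports.

Local Open Scope classical_set_scope.
Local Open Scope ring_scope.

(* The inner product is linear in its first argument and conjugate-linear in
   its second one; the topology is the norm topology of the underlying module. *)
HB.mixin Record CompleteNormedModule_isHilbert (R : realType) H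
    & CompleteNormedModule R[i] H := {
  hdot : {dot H for (@Num.conj R[i])} ;
  hdot_norm : forall x : H, hdot x x = `|x| ^+ 2
}.

#[short(type="hilbertType")]
HB.structure Definition Hilbert (R : realType) :=
  {H of CompleteNormedModule R[i] H & CompleteNormedModule_isHilbert R H}.

Definition separable (T : topologicalType) : Prop :=
  exists2 D : set T, countable D & dense D.

Section Operators.
Context (R : realType).

(* In a normed module over R[i] the norm `|x| is an element of R[i] with zero
   imaginary part; rnorm is the same number as an element of R. *)
Definition rnorm (V : normedModType R[i]) (x : V) : R := complex.Re `|x|.

Definition opnorm (V W : normedModType R[i]) (A : V -> W) : \bar R :=
  ereal_sup [set (rnorm (A x))%:E | x in [set x | rnorm x <= 1]].

Record bounded_operator (G K : hilbertType R) := BoundedOperator {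
  op_val :> {linear G -> K} ;
  op_bounded : (opnorm op_val < +oo)%E
}.

Definition power_bounded (G : hilbertType R) (A : bounded_operator G G) : Prop :=
  (ereal_sup [set opnorm (iter n A) | n in [set n | (1 <= n)%N]] < +oo)%E.

Definition bounded_backward_sequence (G : hilbertType R)
    (A : bounded_operator G G) (x : nat -> G) : Prop :=
  bounded_fun x /\ forall n, A (x n.+1) = x n.

Definition is_adjoint (G K : hilbertType R)
    (A : bounded_operator G K) (B : bounded_operator K G) : Prop :=
  forall x y, hdot (A x) y = hdot x (B y).

Lemma is_adjoint_unique (G K : hilbertType R) (A : bounded_operator G K)
    (B B' : bounded_operator K G) :
  is_adjoint A B -> is_adjoint A B' -> B =1 B'.
Proof.
move=> AB AB' y; apply/eqP; rewrite -subr_eq0; apply/negPn/negP.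
move=> /(@neq0_dnorm_gt0 _ _ _ (@hdot R G)).
by rewrite linearB /= -AB -AB' subrr ltxx.
Qed.

Definition unitary (G : hilbertType R) (U : bounded_operator G G) : Prop :=
  exists V : bounded_operator G G, [/\ is_adjoint U V, cancel U V & cancel V U].

Definition class_C0dot (G : hilbertType R) (A : bounded_operator G G) : Prop :=
  forall x, limn_einf (fun n => (rnorm (iter n A x))%:E) = 0%E.

(* The adjoint exists by the Riesz representation theorem and is unique by
   is_adjoint_unique, so that B below is the adjoint of A. *)
Definition class_Cdot0 (G : hilbertType R) (A : bounded_operator G G) : Prop :=
  exists B : bounded_operator G G, is_adjoint A B /\ class_C0dot B.

End Operators.

Section ClosedSubspaces.
Context (R : realType) (H : hilbertType R).

Record closed_subspace := ClosedSubspace {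
  subspace_set : set H ;
  subspace_submod : submod_closed (mem subspace_set) ;
  subspace_closed : closed subspace_set
}.

Definition in_subspace (M : closed_subspace) : {pred H} :=
  mem (subspace_set M).

HB.instance Definition _ (M : closed_subspace) :=
  GRing.isSubmodClosed.Build R[i] H (in_subspace M) (@subspace_submod M).

Record subspace_of (M : closed_subspace) := SubspaceOf {
  subspace_val : H ;
  subspace_valP : subspace_val \in in_subspace M
}.

HB.instance Definition _ M := [isSub for @subspace_val M].
HB.instance Definition _ M := [Choice of subspace_of M by <:].
HB.instance Definition _ M := [SubChoice_isSubLmodule of subspace_of M by <:].

Section NormedSubspace.
Variable M : closed_subspace.
Local Notation W := (subspace_of M).

Definition subspace_norm (x : W) : R[i] := `|val x|.

Fact subspace_normD (x y : W) :
  subspace_norm (x + y) <= subspace_norm x + subspace_norm y.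
Proof. exact: ler_normD. Qed.

Fact subspace_normZ (l : R[i]) (x : W) :
  subspace_norm (l *: x) = `|l| * subspace_norm x.
Proof. exact: normrZ. Qed.

Fact subspace_norm0_eq0 (x : W) : subspace_norm x = 0 -> x = 0.
Proof. by move=> /normr0_eq0 x0; apply: val_inj; rewrite x0. Qed.

HB.instance Definition _ := Lmodule_isNormed.Build R[i] W
  subspace_normD subspace_normZ subspace_norm0_eq0.

HB.instance Definition _ := isPointed.Build W 0.

Lemma subspace_complete (F : set_system W) :
  ProperFilter F -> cauchy F -> cvg F.
Proof.
move=> FF /cauchyP Fc.
have valFc : cauchy (val @ F).
  apply/cauchyP => e e0; have [x Fx] := Fc e e0; exists (val x).
  by move: Fx; rewrite -!ball_normE.
have /cvg_ex[/= l Fl] : cvg (val @ F) by exact: cauchy_cvg.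
have Ml : subspace_set M l.
  apply: (closed_cvg (subspace_set M) (@subspace_closed M) _ _ Fl).
  by apply: nearW => x; rewrite -in_setE; exact: (subspace_valP x).
apply/cvg_ex; exists (SubspaceOf (mem_set Ml) : W).
apply/cvgrPdist_lt => e e0.
by move/cvgrPdist_lt : Fl => /(_ e e0).
Qed.

HB.instance Definition _ := Uniform_isComplete.Build W subspace_complete.

Definition subspace_dot (x y : W) : R[i] := hdot (val x) (val y).

Fact subspace_dot_bilinear :
  bilinear_for *%R ((@Num.conj R[i]) \; *%R) subspace_dot.
Proof.
split=> [y a u v|x a u v]; rewrite /subspace_dot linearP.
  exact: linearPl.
by [].
Qed.

HB.instance Definition _ :=
  bilinear_isBilinear.Build R[i] W W R[i] _ _ subspace_dot subspace_dot_bilinear.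

Fact subspace_dot_hermitian (x y : W) :
  subspace_dot x y = (-1) ^+ false * Num.conj (subspace_dot y x).
Proof. exact: hermitian_subproof. Qed.

HB.instance Definition _ := isHermitianSesquilinear.Build R[i] W false
  (@Num.conj R[i]) subspace_dot subspace_dot_hermitian.

Fact subspace_dot_gt0 (x : W) : x != 0 -> 0 < subspace_dot x x.
Proof. by move=> x0; apply: neq0_dnorm_gt0; rewrite -(inj_eq val_inj) in x0. Qed.

HB.instance Definition _ :=
  isDotProduct.Build R[i] W subspace_dot subspace_dot_gt0.

Fact subspace_dot_norm (x : W) :
  (subspace_dot : {dot W for (@Num.conj R[i])}) x x = `|x| ^+ 2.
Proof. exact: (hdot_norm (val x)). Qed.

HB.instance Definition _ :=
  CompleteNormedModule_isHilbert.Build R W subspace_dot_norm.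

End NormedSubspace.
End ClosedSubspaces.

Definition orthogonal_decomposition (R : realType) (H : hilbertType R)
    (H1 H2 : closed_subspace H) : Prop :=
  (forall (a : subspace_of H1) (b : subspace_of H2), hdot (val a) (val b) = 0) /\
  (forall x : H, exists (a : subspace_of H1) (b : subspace_of H2),
     x = val a + val b).

(* Main.v *)
Require Import Defs.
From HB Require Import structures.
From mathcomp Require Import all_boot all_order all_algebra.
From mathcomp Require Import complex.
From mathcomp Require Import all_classical all_reals all_analysis.
From mathcomp Require Import ring lra.

(** Let [X] be the set of origins [x_0] of bounded backward sequences of [T].
    It is a subspace with [T X = X]. If backward sequences have constant norm,
    [T] is isometric on [X], so once [X] is known to be closed the restriction
    of [T] to [X] is unitary and the matrix of [T] with respect to the
    orthogonal complement of [X] and [X] is lower triangular. Two facts remain: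
    [X] is closed, and [T11] is of class C_{.0}.

    Both come from one construction ([backward_weak_limit]). Given a bounded
    sequence [v], the weak limits [z_m] of [T^(n - m) v_n] along a fixed
    ultrafilter containing the cofinite sets form a bounded backward sequence,
    because [T] is power-bounded and weakly continuous; its origin is the weak
    limit of [T^n v_n].

    For closedness ([backward_origins_closed]), a limit [x] of origins [x^n] is
    the origin obtained when [v_n] is the [n]-th term of a backward sequence of
    origin [x^n]: then [T^n v_n = x^n], and [v_n] has the norm of [x^n].

    For the class C_{.0} ([adjoint_orbit_small]), the adjoint of [T11] is the
    restriction of the adjoint [T*] to the complement of [X]; taking
    [v_n = T*^n y] with [y] orthogonal to [X] gives an origin [z_0] whose inner
    product with [y] is the limit of [|T*^n y|^2]. This is 0, so the orbit of
    [y] cannot stay away from 0.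

    Conversely ([unitary_C0_norm_const]), a power of the adjoint of [T11] makes
    the component of a bounded backward sequence in the first subspace
    arbitrarily small, so that the sequence lives in the second one, where [T]
    is unitary.

    Weak limits, adjoints and orthogonal projections are all instances of the
    Riesz representation theorem ([riesz]), which is proved for the
    underlying real inner product by minimising a quadratic functional. *)

Set Implicit Arguments.
Unset Strict Implicit.
Unset Printing Implicit Defensive.

Import Order.TTheory GRing.Theory Num.Theory.
Import numFieldNormedType.Exports.

Local Open Scope classical_set_scope.
Local Open Scope ring_scope.
Local Open Scope complex_scope.

(** * The underlying real inner product *)

(** The discriminant criterion; evaluating the polynomial at its vertex
    [- b / c] gives it, and [c = 0] leaves an affine function. *)
Lemma quadratic_ge0_discr (R : realFieldType) (e b c : R) : 0 <= c ->
  (forall t, 0 <= e + 2 * t * b + t ^+ 2 * c) -> b ^+ 2 <= e * c.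
Proof.
rewrite le_eqVlt => /predU1P[<-|c0] h; last first.
  have := h (- b / c).
  have -> : e + 2 * (- b / c) * b + (- b / c) ^+ 2 * c = (e * c - b ^+ 2) / c.
    by field; rewrite gt_eqF.
  by rewrite pmulr_lge0 ?invr_gt0// subr_ge0.
rewrite mulr0; have [->|b0] := eqVneq b 0; first by rewrite expr0n.
have := h (- (e + 1) / (2 * b)).
have -> : e + 2 * (- (e + 1) / (2 * b)) * b + (- (e + 1) / (2 * b)) ^+ 2 * 0 = -1.
  by field.
by rewrite lerNr oppr0 ler10.
Qed.

Section RealInnerProduct.
Context (R : realType) (G : hilbertType R).
Implicit Types (x y z : G) (a : R).

(** The complex Hilbert space seen as a real one. Its real inner product has the
    same norm and determines the complex one ([hdotE]), and real functionals
    and real limits can be handled with the order of [R]. *)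
Definition rdot x y : R := complex.Re (hdot x y).

Lemma normE x : `|x| = (rnorm x)%:C.
Proof. by rewrite /rnorm RRe_real// ger0_real. Qed.

Lemma rnorm_ge0 x : 0 <= rnorm x.
Proof. by have := normr_ge0 x; rewrite normE lecR. Qed.

Lemma rdotxx x : rdot x x = rnorm x ^+ 2.
Proof. by rewrite /rdot hdot_norm normE -rmorphXn. Qed.

Lemma rnorm_eq0 x : rnorm x = 0 -> x = 0.
Proof. by move=> x0; apply: normr0_eq0; rewrite normE x0. Qed.

Lemma rnormD x y : rnorm (x + y) <= rnorm x + rnorm y.
Proof. by rewrite -lecR rmorphD/= -!normE ler_normD. Qed.

Lemma rnormZ a x : rnorm (a%:C *: x) = `|a| * rnorm x.
Proof.
apply: complexI; rewrite rmorphM/= -!normE normrZ.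
by rewrite normc_def/= expr0n addr0 sqrtr_sqr.
Qed.

Lemma Re_norm_ge0 (c : R[i]) : 0 <= complex.Re `|c|.
Proof. by have := normr_ge0 c; rewrite lecE => /andP[]. Qed.

Lemma rnorm_scale (c : R[i]) x : rnorm (c *: x) = complex.Re `|c| * rnorm x.
Proof.
by apply: complexI; rewrite rmorphM/= -normE normrZ RRe_real ?normr_real// normE.
Qed.

Lemma rnormN x : rnorm (- x) = rnorm x.
Proof. by rewrite /rnorm normrN. Qed.

Lemma rnormB x y : rnorm (x - y) = rnorm (y - x).
Proof. by rewrite /rnorm distrC. Qed.

Lemma rnorm0 : rnorm (0 : G) = 0.
Proof. by rewrite /rnorm normr0. Qed.

Lemma hdotC x y : hdot x y = (hdot y x)^*%C.
Proof. by rewrite [LHS](hermC hdot) expr0 mul1r. Qed.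

Lemma rdotC x y : rdot x y = rdot y x.
Proof. by rewrite /rdot hdotC; case: (hdot y x). Qed.

Lemma rdotDl x y z : rdot (x + y) z = rdot x z + rdot y z.
Proof. by rewrite /rdot linearDl raddfD. Qed.

Lemma rdotZl a x y : rdot (a%:C *: x) y = a * rdot x y.
Proof.
by rewrite /rdot linearZl_LR/=; case: (hdot x y) => u v; rewrite /= mul0r subr0.
Qed.

Lemma rdotNl x y : rdot (- x) y = - rdot x y.
Proof. by rewrite /rdot linearNl raddfN. Qed.

Lemma rdotBl x y z : rdot (x - y) z = rdot x z - rdot y z.
Proof. by rewrite rdotDl rdotNl. Qed.

Lemma rdotDr x y z : rdot x (y + z) = rdot x y + rdot x z.
Proof. by rewrite ![rdot x _]rdotC rdotDl. Qed.

Lemma rdotZr a x y : rdot x (a%:C *: y) = a * rdot x y.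
Proof. by rewrite ![rdot x _]rdotC rdotZl. Qed.

Lemma rdotNr x y : rdot x (- y) = - rdot x y.
Proof. by rewrite ![rdot x _]rdotC rdotNl. Qed.

Lemma rdotBr x y z : rdot x (y - z) = rdot x y - rdot x z.
Proof. by rewrite rdotDr rdotNr. Qed.

Lemma rdot0r x : rdot x 0 = 0.
Proof. by rewrite /rdot linear0r. Qed.

Lemma rdot_iZl x y : rdot ('i%C *: x) y = - complex.Im (hdot x y).
Proof.
rewrite /rdot linearZl_LR/=; case: (hdot x y) => u v.
by rewrite /= mul0r mul1r add0r.
Qed.

Lemma hdotE x y : hdot x y = (rdot x y) +i* (- rdot ('i%C *: x) y).
Proof. by rewrite rdot_iZl opprK /rdot; case: (hdot x y). Qed.

Lemma rdot_inj x y : (forall z, rdot z x = rdot z y) -> x = y.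
Proof.
move=> xy; apply/eqP; rewrite -subr_eq0; apply/eqP/rnorm_eq0/eqP.
by rewrite -sqrf_eq0 -rdotxx rdotBr xy subrr.
Qed.

Lemma rnorm_sqrD x y :
  rnorm (x + y) ^+ 2 = rnorm x ^+ 2 + 2 * rdot x y + rnorm y ^+ 2.
Proof. by rewrite -!rdotxx rdotDl !rdotDr [rdot y x]rdotC; ring. Qed.

(** Cauchy-Schwarz: [rnorm (x + t y) ^+ 2] is a nonnegative quadratic
    polynomial in the real variable [t]. *)
Lemma rdot_le x y : `|rdot x y| <= rnorm x * rnorm y.
Proof.
rewrite -ler_sqr ?nnegrE ?mulr_ge0 ?rnorm_ge0// exprMn real_normK ?num_real//.
apply: quadratic_ge0_discr => [|t]; first exact: sqr_ge0.
have := sqr_ge0 (rnorm (x + t%:C *: y)).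
rewrite rnorm_sqrD rnormZ exprMn real_normK ?num_real// rdotZr.
by rewrite mulrA.
Qed.

End RealInnerProduct.

(** * The Riesz representation theorem *)

Lemma le_eps_mul (R : realFieldType) (K D : R) :
  (forall e, 0 < e -> D <= e * K) -> D <= 0.
Proof.
move=> h; rewrite leNgt; apply/negP => D0.
have := h (D / (2 * (`|K| + 1))); rewrite divr_gt0 ?mulr_gt0 ?ltr_wpDl// => /(_ isT).
have K_le := ler_norm K.
rewrite mulrAC ler_pdivlMr ?mulr_gt0 ?ltr_wpDl//.
have := normr_ge0 K; nra.
Qed.

Lemma null_seq (R : realType) : exists d : nat -> R,
  [/\ forall n, 0 < d n, forall n m, (n <= m)%N -> d m <= d n &
      forall e, 0 < e -> exists n, d n < e].
Proof.
exists (fun n => n.+1%:R^-1); split=> [n|n m nm|e e0]; first by rewrite invr_gt0.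
  by rewrite lef_pV2 ?posrE// ler_nat.
by exists (Num.trunc e^-1); rewrite invf_plt ?posrE// truncnS_gt.
Qed.

Section Riesz.
Context (R : realType) (G : hilbertType R).

Lemma gt0C (e : R[i]) : 0 < e -> exists2 r : R, 0 < r & e = r%:C.
Proof.
case: e => r s; rewrite ltcE/= => /andP[/eqP -> r0]; by exists r.
Qed.

Lemma rnorm_complete (a : nat -> G) :
  (forall e, 0 < e -> exists N, forall n, (N <= n)%N -> rnorm (a N - a n) < e) ->
  exists z, forall e, 0 < e ->
    exists N, forall n, (N <= n)%N -> rnorm (z - a n) < e.
Proof.
move=> ca.
have /cvg_ex[/= z az] : cvg (a @ \oo).
  apply: cauchy_cvg; apply: cauchy_exP => _ /gt0C[e e0 ->].
  have [N aN] := ca e e0; exists (a N); exists N => // n /= Nn.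
  by rewrite -ball_normE/= normE ltcR aN.
exists z => e e0; move/cvgrPdist_lt : az => /(_ e%:C).
rewrite ltcR => /(_ e0)[N _ aN]; exists N => n /aN.
by rewrite normE ltcR.
Qed.

Variables (f : G -> R) (C : R).
Hypothesis fD : forall x y, f (x + y) = f x + f y.
Hypothesis fZ : forall (a : R) x, f (a%:C *: x) = a * f x.
Hypothesis f_le : forall x, `|f x| <= C * rnorm x.

(** An approximate minimiser [a] of [J x = rnorm x ^+ 2 - 2 * f x] almost
    represents [f]: if [J a] is within [d ^+ 2] of the infimum, then
    [d ^+ 2 + 2 t (f y - rdot y a) + t ^+ 2 * rnorm y ^+ 2 >= 0] for all real
    [t], and the discriminant of this polynomial gives the bound. *)
Lemma riesz_approx (d : R) : 0 < d ->
  exists a, forall y, `|f y - rdot y a| <= d * rnorm y.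
Proof.
move=> d0; pose J x := rnorm x ^+ 2 - 2 * f x.
have J_lb : lbound (range J) (- C ^+ 2).
  move=> _ [x _ <-]; have := sqr_ge0 (rnorm x - C).
  have : f x <= C * rnorm x by exact: le_trans (ler_norm _) (f_le x).
  rewrite /J; nra.
have J_inf : has_inf (range J) by split; [exists (J 0), 0 | exists (- C ^+ 2)].
have [_ [a _ <-] Ja] := inf_adherent (exprn_gt0 2 d0) J_inf.
exists a => y.
rewrite -ler_sqr ?nnegrE ?mulr_ge0 ?rnorm_ge0 ?(ltW d0)//.
rewrite exprMn real_normK ?num_real//.
apply: quadratic_ge0_discr => [|t]; first exact: sqr_ge0.
have := ge_inf J_inf.2 (imageT J (a - t%:C *: y)).
rewrite {2}/J rnorm_sqrD rnormN rnormZ exprMn real_normK ?num_real//.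
rewrite rdotNr rdotZr [rdot a y]rdotC => J_le.
have fE : f (a - t%:C *: y) = f a - t * f y.
  by rewrite fD -[- _](scaleN1r) -[in -1](rmorph1 (real_complex R)) -rmorphN/= !fZ; ring.
by move: Ja J_le; rewrite fE /J; lra.
Qed.

(** Two vectors that represent [f] up to [d] and [d'] are at distance at most
    [d + d'], so approximate representatives with errors tending to 0 form a
    Cauchy sequence. Its limit represents [f]. *)
Lemma riesz : exists z, forall y, f y = rdot y z.
Proof.
have [d [d0 d_le d_small]] := null_seq R.
have [a fa] := choice (fun n => riesz_approx (d0 n)).
have [z az] : exists z, forall e, 0 < e ->
    exists N, forall n, (N <= n)%N -> rnorm (z - a n) < e.
  apply: rnorm_complete => e e0.
  have [N Ne] : exists N, d N < e / 2 by apply: d_small; rewrite divr_gt0.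
  exists N => n /d_le dn.
  set y := a N - a n.
  have : rnorm y * rnorm y <= (d N + d n) * rnorm y.
    rewrite -expr2 -rdotxx [leLHS]rdotBr.
    have := fa N y; have := fa n y; rewrite !ler_norml mulrDl.
    by move=> /andP[h1 h2] /andP[h3 h4]; lra.
  have [-> _|y0] := eqVneq (rnorm y) 0; first by [].
  rewrite ler_pM2r ?lt_def ?y0 ?rnorm_ge0//; lra.
exists z => y; apply/eqP; rewrite -subr_eq0 -normr_le0.
apply: (@le_eps_mul _ (2 * rnorm y)) => e e0.
have [N zN] := az e e0.
have [M Me] := d_small e e0.
have /zN zn : (N <= N + M)%N by rewrite leq_addr.
have /d_le dn : (M <= N + M)%N by rewrite leq_addl.
have := fa (N + M)%N y; have := rdot_le y (z - a (N + M)%N).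
have y0 := rnorm_ge0 y; rewrite rdotBr !ler_norml.
by move=> /andP[h1 h2] /andP[h3 h4]; apply/andP; split; nra.
Qed.
End Riesz.

(** * Bounded operators, adjoints and compressions *)

Section BoundedOperators.
Context (R : realType).
Implicit Types G K L : hilbertType R.

Lemma lty_le_fin (s : \bar R) : (s < +oo)%E -> exists2 C, 0 <= C & (s <= C%:E)%E.
Proof.
case: s => [r _|//|_]; first by exists `|r|; rewrite ?lee_fin ?ler_norm.
by exists 0; rewrite ?leNye.
Qed.

(** Stated for functions that are merely homogeneous over the reals, since the
    powers [iter n T] are not bundled as linear maps. *)
Lemma opnorm_le G K (f : G -> K) C : 0 <= C ->
  (forall (a : R) x, f (a%:C *: x) = a%:C *: f x) ->
  (opnorm f <= C%:E)%E -> forall x, rnorm (f x) <= C * rnorm x.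
Proof.
move=> C0 fZ fC x; have [x0|x0] := eqVneq (rnorm x) 0.
  by have := fZ 0 x; rewrite (rnorm_eq0 x0) !scale0r => ->; rewrite !rnorm0 mulr0.
have : ((rnorm (f ((rnorm x)^-1%:C *: x)))%:E <= C%:E)%E.
  apply: le_trans fC; apply: ereal_sup_ubound; exists ((rnorm x)^-1%:C *: x) => //=.
  by rewrite rnormZ ger0_norm ?invr_ge0 ?rnorm_ge0// mulVf.
rewrite lee_fin fZ rnormZ ger0_norm ?invr_ge0 ?rnorm_ge0//.
by rewrite mulrC ler_pdivrMr// lt_def x0 rnorm_ge0.
Qed.

Lemma opnorm_lty G K (f : G -> K) C : 0 <= C ->
  (forall x, rnorm (f x) <= C * rnorm x) -> (opnorm f < +oo)%E.
Proof.
move=> C0 fC; apply: (@le_lt_trans _ _ C%:E); last exact: ltry.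
apply: ub_ereal_sup => _ [x /= x1 <-]; rewrite lee_fin.
by apply: le_trans (fC x) _; rewrite ler_piMr.
Qed.

Lemma op_le G K (A : bounded_operator G K) :
  exists2 C, 0 <= C & forall x, rnorm (A x) <= C * rnorm x.
Proof.
have [C C0 AC] := lty_le_fin (op_bounded A); exists C => //.
by apply: opnorm_le AC => // a x; rewrite linearZ.
Qed.

Lemma power_bounded_le G (A : bounded_operator G G) : power_bounded A ->
  exists2 C, 0 <= C & forall n x, rnorm (iter n A x) <= C * rnorm x.
Proof.
move=> /lty_le_fin[C C0 AC]; exists (1 + C) => [|[|n] x]; first by rewrite addr_ge0.
  by rewrite ler_peMl ?rnorm_ge0// lerDl.
apply: (@le_trans _ _ (C * rnorm x)); last by rewrite ler_wpM2r ?rnorm_ge0// lerDr.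
apply: opnorm_le => // [a y|].
  by elim: n.+1 => //= m ->; rewrite linearZ.
by apply: le_trans AC; apply: ereal_sup_ubound; exists n.+1.
Qed.

Lemma bounded_operator_of G K (f : G -> K) C : linear f -> 0 <= C ->
  (forall x, rnorm (f x) <= C * rnorm x) ->
  exists A : bounded_operator G K, A =1 f.
Proof.
move=> fL C0 fC.
pose F : {linear G -> K} := HB.pack f (GRing.isLinear.Build R[i] G K *:%R f fL).
by exists (@BoundedOperator _ _ _ F (opnorm_lty C0 fC)).
Qed.

Lemma comp_op G K L (A : bounded_operator K L) (B : bounded_operator G K) :
  exists AB : bounded_operator G L, AB =1 A \o B.
Proof.
have [C C0 AC] := op_le A; have [D D0 BD] := op_le B.
apply: (@bounded_operator_of _ _ _ (C * D)); first by move=> a x y /=; rewrite !linearP.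
  exact: mulr_ge0.
by move=> x; apply: le_trans (AC _) _; rewrite -mulrA ler_wpM2l.
Qed.

Lemma is_adjointP G K (A : bounded_operator G K) (B : bounded_operator K G) :
  (forall x y, rdot (A x) y = rdot x (B y)) <-> is_adjoint A B.
Proof.
split=> AB x y; last by rewrite /rdot AB.
by rewrite !hdotE -linearZ/= !AB.
Qed.

Lemma hdotPr G (x u v : G) (a : R[i]) :
  hdot x (a *: u + v) = a^*%C * hdot x u + hdot x v.
Proof. exact: linearPr. Qed.

(** The value of the adjoint at [y] is the Riesz representative of the
    functional [x |-> rdot (A x) y]. *)
Lemma adjoint_exists G K (A : bounded_operator G K) : exists B, is_adjoint A B.
Proof.
have [C C0 AC] := op_le A.
have represented y : exists z, forall x, rdot (A x) y = rdot x z.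
  apply: (@riesz _ _ _ (C * rnorm y)) => [x z|a x|x].
  - by rewrite linearD rdotDl.
  - by rewrite linearZ rdotZl.
  - by apply: le_trans (rdot_le _ _) _; rewrite mulrAC ler_wpM2r ?rnorm_ge0.
have [b Ab] := choice represented.
have hAb y x : hdot (A x) y = hdot x (b y) by rewrite !hdotE -linearZ/= !Ab.
have bL : linear b.
  move=> a u v; apply: rdot_inj => x; rewrite -Ab /rdot.
  by rewrite hdotPr !hAb -hdotPr.
have b_le y : rnorm (b y) <= C * rnorm y.
  have [->|y0] := eqVneq (rnorm (b y)) 0; first by rewrite mulr_ge0 ?rnorm_ge0.
  have y1 : 0 < rnorm (b y) by rewrite lt_def y0 rnorm_ge0.
  rewrite -(ler_pM2r y1) -expr2 -rdotxx -Ab.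
  apply: le_trans (ler_norm _) _; apply: le_trans (rdot_le _ _) _.
  by rewrite mulrAC ler_wpM2r ?rnorm_ge0.
have [B Bb] := bounded_operator_of bL C0 b_le.
by exists B; apply/is_adjointP => x y; rewrite Ab Bb.
Qed.

End BoundedOperators.

Section Compression.
Context (R : realType) (H : hilbertType R).
Implicit Types M N : closed_subspace H.

Lemma rdot_val M (u v : subspace_of M) : rdot u v = rdot (val u) (val v).
Proof. by []. Qed.

Lemma rnorm_val M (u : subspace_of M) : rnorm u = rnorm (val u).
Proof. by []. Qed.

Lemma inclusion_op M : exists I : bounded_operator (subspace_of M) H, I =1 val.
Proof.
by apply: (@bounded_operator_of _ _ _ _ 1) => // x; rewrite mul1r.
Qed.

(** The orthogonal projection onto [M] is the adjoint of the inclusion. *)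
Lemma projection_op M : exists P : bounded_operator H (subspace_of M),
  forall x u, rdot (P x) u = rdot x (val u).
Proof.
have [I Iv] := inclusion_op M; have [P /is_adjointP IP] := adjoint_exists I.
by exists P => x u; rewrite rdotC -IP Iv rdotC.
Qed.

(** The compression of [T] from [M] to [N], the composite of the inclusion of
    [M], of [T] and of the projection onto [N]. All three blocks of the matrix
    of [T] are compressions. *)
Lemma compression_op M N (T : bounded_operator H H) :
  exists A : bounded_operator (subspace_of M) (subspace_of N),
    forall u v, rdot (A u) v = rdot (T (val u)) (val v).
Proof.
have [I Iv] := inclusion_op M; have [P PE] := projection_op N.
have [TI TIE] := comp_op T I; have [A AE] := comp_op P TI.
by exists A => u v; rewrite AE/= PE TIE/= Iv.
Qed.

End Compression.

(** * Weak limits along ultrafilters *)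

Section WeakLimits.
Context (R : realType).
Implicit Type H : hilbertType R.

Lemma ultrafilter_limit I (F : set_system I) (FU : UltraFilter F) (u : I -> R) C :
  (forall i, `|u i| <= C) -> exists l : R, u @ F --> l.
Proof.
move=> uC.
pose G : set_system R := [set A | F (u @^-1` A)].
have [|l [_ lF]] := @segment_compact R (- C) C G (fmap_proper_filter u _).
  by apply: nearW => i /=; rewrite in_itv/= -ler_norml uC.
exists l => A lA; have [//|FA] := in_ultra_setVsetC (u @^-1` A) FU.
have [] := lF (~` A) A _ lA; first exact: FA.
by move=> t [].
Qed.

(** The limits of the bounded real families [rdot (v i) y] depend linearly on
    [y], and [z] is the Riesz representative of this functional. *)
Lemma weak_limit H I (F : set_system I) (FU : UltraFilter F) (v : I -> H) C :
  0 <= C -> (forall i, rnorm (v i) <= C) ->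
  exists2 z, rnorm z <= C &
    forall y, rdot (v i) y @[i --> F] --> rdot z y.
Proof.
move=> C0 vC.
have v_le y i : `|rdot (v i) y| <= C * rnorm y.
  by apply: le_trans (rdot_le _ _) _; rewrite ler_wpM2r ?rnorm_ge0.
have [f fv] := choice (fun y => ultrafilter_limit FU (v_le y)).
have [x y|a x|x|z fz] := @riesz _ _ f C.
- apply: (cvg_unique _ (fv (x + y))); first exact: norm_hausdorff.
  apply: cvg_trans (cvgD (fv x) (fv y)); apply: near_eq_cvg.
  by apply: nearW => i /=; rewrite rdotDr.
- apply: (cvg_unique _ (fv (a%:C *: x))); first exact: norm_hausdorff.
  apply: cvg_trans (cvgMl_tmp (fv x)); apply: near_eq_cvg.
  by apply: nearW => i /=; rewrite rdotZr.
- apply: (closed_cvg _ (@closed_le R (C * rnorm x)) _ _ (cvg_norm (fv x))).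
  exact: nearW (v_le x).
have zv y : rdot (v i) y @[i --> F] --> rdot z y by rewrite rdotC -fz.
exists z => //; have [->//|z0] := eqVneq (rnorm z) 0.
have z1 : 0 < rnorm z by rewrite lt_def z0 rnorm_ge0.
rewrite -(ler_pM2r z1) -expr2 -rdotxx.
apply: (closed_cvg _ (@closed_le R (C * rnorm z)) _ _ (zv z)).
by apply: nearW => i; exact: le_trans (ler_norm _) (v_le z i).
Qed.

Lemma bounded_rnormP H (x : nat -> H) :
  bounded_fun x <-> exists2 C, 0 <= C & forall n, rnorm (x n) <= C.
Proof.
split=> [[M [Mr xM]]|[C C0 xC]].
  exists (1 + `|complex.Re M|) => [|n]; first by rewrite addr_ge0.
  have /= := xM (1 + `|complex.Re M|)%:C _ n I; rewrite normE lecR; apply.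
  by rewrite -[M]RRe_real// ltcR ltr_pwDl// ler_norm.
exists C%:C; split=> [|M CM n _ /=]; first by rewrite realE lecR C0.
by apply: le_trans (ltW CM); rewrite normE lecR.
Qed.

(** The source of backward sequences: [z m] is the weak limit of
    [T^(n - m) (v n)]. Since [T] is weakly continuous, as shown by moving it to
    the other side of the inner product, [T (z m.+1)] is the weak limit of
    [T^(n - m) (v n)] as well. Power-boundedness bounds all these vectors
    uniformly. *)
Lemma backward_weak_limit H (T S : bounded_operator H H) (F : set_system nat)
    (FU : UltraFilter F) (v : nat -> H) C :
  is_adjoint T S -> power_bounded T -> \oo `<=` F ->
  0 <= C -> (forall n, rnorm (v n) <= C) ->
  exists z, bounded_backward_sequence T z /\
    forall y, rdot (iter n T (v n)) y @[n --> F] --> rdot (z 0) y.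
Proof.
move=> /is_adjointP TS /power_bounded_le[K K0 TK] Foo C0 vC.
(* truncated subtraction: only the terms with [m <= n] matter in the limit *)
have iter_le m n : rnorm (iter (n - m) T (v n)) <= K * C.
  by apply: le_trans (TK _ _) _; rewrite ler_wpM2l.
have /choice[z zP] m : exists z, rnorm z <= K * C /\
    forall y, rdot (iter (n - m) T (v n)) y @[n --> F] --> rdot z y.
  by have [z] := weak_limit FU (mulr_ge0 K0 C0) (iter_le m); exists z.
exists z; split; last first.
  move=> y; apply: cvg_trans ((zP 0).2 y); apply: near_eq_cvg.
  by apply: nearW => n; rewrite subn0.
split.
  apply/bounded_rnormP; exists (K * C) => [|n]; first exact: mulr_ge0.
  exact: (zP n).1.
move=> m; apply: rdot_inj => y; rewrite ![rdot y _]rdotC TS.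
apply: (cvg_unique _ ((zP m.+1).2 (S y))); first exact: norm_hausdorff.
apply: cvg_trans ((zP m).2 y); apply: near_eq_cvg.
apply: Foo; exists m.+1 => // n /= mn.
by rewrite -TS -iterS -subSn// subSS.
Qed.

End WeakLimits.

(** * Lower limits *)

Section LowerLimit.
Context (R : realType).
Implicit Type u : nat -> R.

Lemma limn_einf_eq0 u : (forall n, 0 <= u n) ->
  (limn_einf (fun n => (u n)%:E) = 0)%E <->
  (forall e, 0 < e -> forall N, exists2 n, (N <= n)%N & u n < e).
Proof.
move=> u0; rewrite limn_einf_lim; set v := fun n => (u n)%:E; split.
  move=> lim0 e e0 N.
  have : (einfs v N <= 0)%E.
    rewrite -lim0 (cvg_lim _ (ereal_nondecreasing_cvgn (nondecreasing_einfs v)))//.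
    by apply: ereal_sup_ubound; exists N.
  rewrite -lte_fin in e0; move=> /le_lt_trans/(_ e0)/ereal_inf_lt[_ [n /= Nn <-]].
  by rewrite lte_fin; exists n.
move=> small; suff -> : einfs v = cst 0%E by rewrite lim_cst.
apply/funext => N; apply/eqP; rewrite eq_le; apply/andP; split; last first.
  by apply: le_ereal_inf_tmp => _ [n _ <-]; rewrite lee_fin.
apply/lee_addgt0Pr => e e0; rewrite add0e.
have [n Nn un] := small e e0 N.
apply: (@le_trans _ _ (v n)); last by rewrite lee_fin ltW.
by apply: ereal_inf_lbound; exists n.
Qed.

End LowerLimit.

(** * Closed subspaces, isometries and unitaries *)

Section Subspaces.
Context (R : realType) (H : hilbertType R).
Implicit Types M N : closed_subspace H.

Lemma closed_rnorm (A : set H) :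
  (forall x, (forall e, 0 < e -> exists2 y, A y & rnorm (x - y) < e) -> A x) ->
  closed A.
Proof.
move=> Acl x xA; apply: Acl => e e0.
have [|y [Ay]] := xA (ball x e%:C); first by apply: nbhsx_ballx; rewrite ltcR.
by rewrite -ball_normE/= normE ltcR; exists y.
Qed.

Lemma kernel_subspace (K : hilbertType R) (A : bounded_operator H K) :
  exists M, subspace_set M = [set x | A x = 0].
Proof.
have Asub : submod_closed (mem [set x | A x = 0]).
  split=> [|a x y]; rewrite !inE/= ?linear0// linearP => -> ->.
  by rewrite scaler0 addr0.
have [C C0 AC] := op_le A.
have Acl : closed [set x | A x = 0].
  apply: closed_rnorm => x xA; apply: rnorm_eq0; apply/eqP.
  rewrite -normr_le0 ger0_norm ?rnorm_ge0//; apply: (@le_eps_mul _ C) => e e0.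
  have [y /= Ay xy] := xA e e0.
  rewrite -[A x]subr0 -Ay -linearB; apply: le_trans (AC _) _.
  by rewrite mulrC ler_wpM2r// ltW.
by exists (ClosedSubspace Asub Acl).
Qed.

(** The complement of [M] is the kernel of the projection onto [M]. *)
Lemma orthogonal_complement M : exists N, orthogonal_decomposition N M /\
  forall x, subspace_set N x <-> forall u : subspace_of M, rdot x (val u) = 0.
Proof.
have [P PE] := projection_op M; have [N NE] := kernel_subspace P.
have NP x : subspace_set N x <-> forall u : subspace_of M, rdot x (val u) = 0.
  rewrite NE/=; split=> [Px u|xM]; first by rewrite -PE Px rdotC rdot0r.
  by apply: rdot_inj => u; rewrite rdotC PE xM rdot0r.
exists N; split=> //; split=> [a b|x].
  have aN : val a \in in_subspace N := valP a.
  have iaN : 'i%C *: val a \in in_subspace N by rewrite rpredZ.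
  move: aN iaN; rewrite !inE => /NP aN /NP iaN.
  by rewrite hdotE aN iaN oppr0.
have xN : x - val (P x) \in in_subspace N.
  by rewrite inE; apply/NP => u; rewrite rdotBl -PE rdot_val subrr.
by exists (SubspaceOf xN), (P x); rewrite subrK.
Qed.

Lemma hdot0_rdot0 (x y : H) : hdot x y = 0 -> rdot x y = 0.
Proof. by rewrite /rdot => ->. Qed.

Lemma compression_eq M N (T : bounded_operator H H)
    (A : bounded_operator (subspace_of M) (subspace_of N))
    (AE : forall u v, rdot (A u) v = rdot (T (val u)) (val v))
    (u : subspace_of M) (w : subspace_of N) :
  (forall v : subspace_of N, rdot (T (val u)) (val v) = rdot (val w) (val v)) ->
  A u = w.
Proof. by move=> Tw; apply: rdot_inj => v; rewrite rdotC AE Tw rdotC. Qed.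

(** By polarization an isometry preserves the inner product, so its adjoint is
    a left inverse. Surjectivity makes it a right inverse. *)
Lemma isometry_unitary (U : bounded_operator H H) :
  (forall x, rnorm (U x) = rnorm x) -> (forall y, exists x, U x = y) -> unitary U.
Proof.
move=> Uiso Usurj; have [V UV] := adjoint_exists U; have /is_adjointP UVr := UV.
have Udot x y : rdot (U x) (U y) = rdot x y.
  have := rnorm_sqrD (U x) (U y); rewrite -linearD !Uiso rnorm_sqrD; lra.
have UK : cancel U V by move=> x; apply: rdot_inj => z; rewrite -UVr Udot.
exists V; split=> // y; have [x <-] := Usurj y; by rewrite UK.
Qed.

Lemma unitary_isometry (U : bounded_operator H H) :
  unitary U -> forall x, rnorm (U x) = rnorm x.
Proof.
move=> [V [/is_adjointP UV UK _]] x; apply/eqP.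
rewrite -(@eqrXn2 _ 2) ?rnorm_ge0//; apply/eqP.
by rewrite -!rdotxx UV UK.
Qed.

Lemma iter_adjoint (T S : bounded_operator H H) : is_adjoint T S ->
  forall n x y, rdot (iter n T x) y = rdot x (iter n S y).
Proof. by move=> /is_adjointP TS; elim=> //= n IH x y; rewrite TS IH -iterSr. Qed.

End Subspaces.

(** * Origins of bounded backward sequences *)

Section BackwardSequences.
Context (R : realType) (H : hilbertType R) (T : bounded_operator H H).
Hypothesis Tpb : power_bounded T.

Definition backward_origins : set H :=
  [set x | exists2 s, bounded_backward_sequence T s & s 0 = x].

Lemma iter_backward s (sT : bounded_backward_sequence T s) n : iter n T (s n) = s 0.
Proof. by elim: n => // n IH; rewrite iterSr sT.2. Qed.

Lemma backward_origins_submod : submod_closed (mem backward_origins).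
Proof.
split=> [|a x y]; rewrite !inE.
  exists (fun=> 0) => //; split=> [|n]; last by rewrite linear0.
  by apply/bounded_rnormP; exists 0 => // n; rewrite rnorm0.
move=> [s [/bounded_rnormP[C C0 sC] sT] <-] [t [/bounded_rnormP[D D0 tD] tT] <-].
exists (fun n => a *: s n + t n) => //; split=> [|n]; last by rewrite linearP sT tT.
apply/bounded_rnormP; exists (complex.Re `|a| * C + D) => [|n].
  by rewrite addr_ge0// mulr_ge0// Re_norm_ge0.
apply: le_trans (rnormD _ _) _; apply: lerD => //.
by rewrite rnorm_scale ler_wpM2l// Re_norm_ge0.
Qed.

Lemma backward_origins_shift s (sT : bounded_backward_sequence T s) n :
  backward_origins (s n).
Proof.
exists (fun m => s (n + m)%N); rewrite ?addn0//; case: sT => /bounded_rnormP[C C0 sC] sT.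
by split=> [|m]; [apply/bounded_rnormP; exists C|rewrite addnS sT].
Qed.

(** Prepending [T (s 0)] shows that the set of origins is stable under [T]. *)
Lemma backward_cons s (sT : bounded_backward_sequence T s) :
  bounded_backward_sequence T (fun n => if n is m.+1 then s m else T (s 0)).
Proof.
case: sT => /bounded_rnormP[C C0 sC] sT; split=> [|[|m]//].
apply/bounded_rnormP; exists (C + rnorm (T (s 0))) => [|[|m]].
- by rewrite addr_ge0 ?rnorm_ge0.
- by rewrite lerDr.
- by rewrite ler_wpDr ?rnorm_ge0.
Qed.

(** If [rnorm (S^n y)] stayed above [e], the weak limit of [T^n (S^n y)] would be
    the origin [z 0] of a bounded backward sequence, and [rdot (z 0) y], the
    limit of [rnorm (S^n y) ^+ 2], would be at least [e ^+ 2], although [y] is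
    orthogonal to all origins. *)
Lemma adjoint_orbit_small (S : bounded_operator H H) y : is_adjoint T S ->
  (forall x, backward_origins x -> rdot x y = 0) ->
  forall e, 0 < e -> forall N, exists2 n, (N <= n)%N & rnorm (iter n S y) < e.
Proof.
move=> TS yperp e e0 N; apply: contrapT => nsmall.
have large n : (N <= n)%N -> e <= rnorm (iter n S y).
  by move=> Nn; rewrite leNgt; apply/negP => small; apply: nsmall; exists n.
have [K K0 TK] := power_bounded_le Tpb.
have SS n : rdot (iter n T (iter n S y)) y = rnorm (iter n S y) ^+ 2.
  by rewrite (iter_adjoint TS) rdotxx.
have S_le n : rnorm (iter n S y) <= K * rnorm y.
  have [->|S0] := eqVneq (rnorm (iter n S y)) 0; first by rewrite mulr_ge0 ?rnorm_ge0.
  rewrite -(@ler_pM2r _ (rnorm (iter n S y))) ?lt_def ?S0 ?rnorm_ge0//.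
  rewrite -expr2 -SS; apply: le_trans (ler_norm _) _.
  apply: le_trans (rdot_le _ _) _; rewrite mulrAC ler_wpM2r ?rnorm_ge0//.
have [F [FU Foo]] := @ultraFilterLemma nat \oo _.
have Ky : 0 <= K * rnorm y by rewrite mulr_ge0 ?rnorm_ge0.
have [z [zT zlim]] := backward_weak_limit FU TS Tpb Foo Ky S_le.
have : e ^+ 2 <= rdot (z 0) y.
  apply: (closed_cvg _ (@closed_ge R (e ^+ 2)) _ _ (zlim y)).
  apply: Foo; exists N => // n /= /large en.
  by rewrite SS ler_sqr ?nnegrE ?rnorm_ge0// ltW.
by rewrite yperp; [rewrite leNgt exprn_gt0|exists z].
Qed.

Hypothesis norm_const : forall s, bounded_backward_sequence T s ->
  forall m n, `|s m| = `|s n|.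

Lemma rnorm_const s (sT : bounded_backward_sequence T s) n : rnorm (s n) = rnorm (s 0).
Proof. by rewrite /rnorm (norm_const sT n 0). Qed.

Lemma backward_origins_isometry x : backward_origins x -> rnorm (T x) = rnorm x.
Proof. by move=> [s sT <-]; have /= -> := rnorm_const (backward_cons sT) 1. Qed.

(** Let [x] be the limit of origins [s n 0]. The vectors [s n n] satisfy
    [T^n (s n n) = s n 0], and they are bounded because the norms along each
    sequence are constant. The backward sequence that they produce starts at
    the limit of [s n 0], which is [x]. *)
Lemma backward_origins_closed : closed backward_origins.
Proof.
apply: closed_rnorm => x xX; have [S TS] := adjoint_exists T.
have [d [d0 d_le d_small]] := null_seq R.
have approx n : exists s, bounded_backward_sequence T s /\ rnorm (x - s 0) < d n.
  by have [_ [s sT <-] sx] := xX _ (d0 n); exists s.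
have [s sP] := choice approx.
have s_le n : rnorm (s n n) <= rnorm x + d 0%N.
  rewrite rnorm_const; last exact: (sP n).1.
  have := rnormD x (- (x - s n 0)); rewrite opprB addrC subrK rnormB.
  by have := (sP n).2; have := d_le 0%N n isT; rewrite [rnorm (x - _)]rnormB; lra.
have [F [FU Foo]] := @ultraFilterLemma nat \oo _.
have C0 : 0 <= rnorm x + d 0%N by rewrite addr_ge0 ?rnorm_ge0// ltW.
have [z [zT zlim]] := backward_weak_limit FU TS Tpb Foo C0 s_le.
exists z => //; apply: rdot_inj => y; rewrite ![rdot y _]rdotC.
apply: (cvg_unique _ (zlim y)); first exact: norm_hausdorff.
apply: (cvg_trans (G := nbhs (rdot (iter n T (s n n)) y @[n --> \oo]))) => /=.
  by move=> A; exact: Foo.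
apply/cvgrPdist_lt => e e0.
have [N dN] : exists N, d N < e / (rnorm y + 1).
  by apply: d_small; rewrite divr_gt0// ltr_wpDl ?rnorm_ge0.
exists N => // n /= /d_le dn; rewrite iter_backward; last exact: (sP n).1.
rewrite -rdotBl; apply: le_lt_trans (rdot_le _ _) _.
move: dN; rewrite ltr_pdivlMr ?ltr_wpDl ?rnorm_ge0//.
have := (sP n).2; have := rnorm_ge0 y; have := rnorm_ge0 (x - s n 0).
have := d0 N; nra.
Qed.

End BackwardSequences.

(** * Block-triangular operators *)

Section Decomposition.
Context (R : realType) (H : hilbertType R).
Implicit Types M N : closed_subspace H.

Lemma decomposition_unique M N : orthogonal_decomposition M N ->
  forall (a a' : subspace_of M) (b b' : subspace_of N),
  val a + val b = val a' + val b' -> a = a' /\ b = b'.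
Proof.
move=> [MN _] a a' b b' E.
have ab : val (a - a') = val (b' - b).
  by rewrite !linearB/=; apply/eqP; rewrite subr_eq addrAC eq_sym subr_eq E addrC.
have aa : a - a' = 0.
  apply: rnorm_eq0; apply/eqP; rewrite -sqrf_eq0 -rdotxx.
  by rewrite rdot_val {2}ab hdot0_rdot0 ?MN.
split; first exact/subr0_eq.
by apply/esym/subr0_eq/val_inj; rewrite -ab aa !linear0.
Qed.

(** The components [a n] in [M] form a bounded backward sequence of [T11], so
    [rnorm (a n) ^+ 2 = rdot (a (n + k)) (B^k (a n))] with [B] the adjoint of
    [T11], and the right-hand side is arbitrarily small for suitable [k]. Hence
    the backward sequence lies in [N], where [T] is the isometry [U]. *)
Lemma unitary_C0_norm_const (T : bounded_operator H H) M N
    (T11 : bounded_operator (subspace_of M) (subspace_of M))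
    (T21 : bounded_operator (subspace_of M) (subspace_of N))
    (U : bounded_operator (subspace_of N) (subspace_of N)) :
  orthogonal_decomposition M N -> unitary U -> class_Cdot0 T11 ->
  (forall (a : subspace_of M) (b : subspace_of N),
     T (val a + val b) = val (T11 a) + (val (T21 a) + val (U b))) ->
  forall x, bounded_backward_sequence T x -> forall m n, `|x m| = `|x n|.
Proof.
move=> MN Uun [B [TB B0]] TE x [/bounded_rnormP[C C0 xC] xT].
have ab_ex n : exists ab : subspace_of M * subspace_of N, x n = val ab.1 + val ab.2.
  by have [a [b ab]] := MN.2 (x n); exists (a, b).
have [ab abE] := choice ab_ex.
pose a n := (ab n).1; pose b n := (ab n).2.
have step n : T11 (a n.+1) = a n /\ T21 (a n.+1) + U (b n.+1) = b n.
  by apply: (decomposition_unique MN); rewrite -abE -xT abE TE linearD.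
have aT k n : iter k T11 (a (n + k)%N) = a n.
  by elim: k => [|k IH]; rewrite ?addn0// iterSr addnS (step _).1.
have a_le n : rnorm (a n) <= C.
  apply: le_trans (xC n); rewrite -ler_sqr ?nnegrE ?rnorm_ge0// abE rnorm_sqrD.
  by rewrite hdot0_rdot0 ?MN.1// mulr0 addr0 rnorm_val lerDl sqr_ge0.
have a0 n : a n = 0.
  apply: rnorm_eq0; apply/eqP; rewrite -sqrf_eq0 -rdotxx -normr_le0.
  apply: (@le_eps_mul _ C) => e e0.
  have small := (limn_einf_eq0 (fun k => rnorm_ge0 (iter k B (a n)))).1 (B0 _).
  have [k _ ke] := small e e0 0%N.
  rewrite -{1}(aT k n) (iter_adjoint TB); apply: le_trans (rdot_le _ _) _.
  by rewrite mulrC; apply: ler_pM; rewrite ?rnorm_ge0 ?a_le ?ltW.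
have xb n : rnorm (x n) = rnorm (x 0%N).
  have xE k : x k = val (b k) by rewrite abE -/(a k) a0 linear0 add0r.
  elim: n => // n <-; rewrite !xE -!rnorm_val -[in RHS](step n).2 a0 linear0 add0r.
  by rewrite (unitary_isometry Uun).
by move=> m n; rewrite !normE !xb.
Qed.

End Decomposition.

(** * The equivalence *)

Theorem theorem4p2 (R : realType) (H : hilbertType R) (Hsep : separable H)
    (T : bounded_operator H H) (Tpb : power_bounded T) :
  (forall x : nat -> H, bounded_backward_sequence T x ->
     forall m n, `|x m| = `|x n|)
  <->
  (exists H1 H2 : closed_subspace H,
     orthogonal_decomposition H1 H2 /\
     exists (T11 : bounded_operator (subspace_of H1) (subspace_of H1))
            (T21 : bounded_operator (subspace_of H1) (subspace_of H2))
            (U : bounded_operator (subspace_of H2) (subspace_of H2)),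
       [/\ unitary U,
           class_Cdot0 T11 &
           forall (a : subspace_of H1) (b : subspace_of H2),
             T (val a + val b) = val (T11 a) + (val (T21 a) + val (U b))]).
Proof.
split=> [norm_const|[H1 [H2 [H12 [T11 [T21 [U [Uun T110 TE]]]]]]]]; last first.
  exact: unitary_C0_norm_const H12 Uun T110 TE.
pose H2 := ClosedSubspace (backward_origins_submod T)
  (backward_origins_closed Tpb norm_const).
have [H1 [H12 H1P]] := orthogonal_complement H2.
have [T11 T11E] := compression_op H1 H1 T.
have [T21 T21E] := compression_op H1 H2 T.
have [U UE] := compression_op H2 H2 T.
have [S TS] := adjoint_exists T; have /is_adjointP TSr := TS.
have H2T x : backward_origins T x -> backward_origins T (T x).
  by move=> [s sT <-]; exists (fun n => if n is m.+1 then s m else T (s 0%N));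
    [exact: backward_cons|].
have valH2 (b : subspace_of H2) : backward_origins T (val b).
  by have := valP b; rewrite inE.
have Uval b : val (U b) = T (val b).
  have Tb : T (val b) \in in_subspace H2 by rewrite inE; exact: H2T.
  by rewrite (compression_eq UE (w := SubspaceOf Tb)).
have valH1 (a : subspace_of H1) (b : subspace_of H2) : rdot (val a) (val b) = 0.
  exact/hdot0_rdot0/H12.1.
(* [H2] is stable under [T], so [H1] is stable under [S], and the adjoint of
   [T11] is the restriction of [S] *)
have Sval (a : subspace_of H1) : S (val a) \in in_subspace H1.
  by rewrite inE; apply/H1P => u; rewrite rdotC -TSr -Uval rdotC valH1.
exists H1, H2; split=> //; exists T11, T21, U; split.
- apply: isometry_unitary => [b|b].
    by rewrite !rnorm_val Uval (backward_origins_isometry norm_const).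
  have [s sT sb] := valH2 b.
  have s1 : s 1%N \in in_subspace H2 by rewrite inE; exact: backward_origins_shift.
  by exists (SubspaceOf s1); apply: val_inj; rewrite Uval/= sT.2.
- have [B TB] := adjoint_exists T11; have /is_adjointP TBr := TB.
  exists B; split=> // y.
  have Bval a : val (B a) = S (val a).
    suff -> : B a = SubspaceOf (Sval a) by [].
    by apply: rdot_inj => v; rewrite -TBr T11E TSr.
  have iterB n : val (iter n B y) = iter n S (val y).
    by elim: n => //= n <-; rewrite Bval.
  apply/limn_einf_eq0 => [n|e e0 N]; first exact: rnorm_ge0.
  have [|n Nn nS] := adjoint_orbit_small Tpb TS (y := val y) _ e0 N.
    move=> x xX; have xH2 : x \in in_subspace H2 by rewrite inE.
    by rewrite rdotC (valH1 y (SubspaceOf xH2)).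
  by exists n => //; rewrite rnorm_val iterB.
- move=> a b; have [p [q pq]] := H12.2 (T (val a)).
  have -> : T11 a = p.
    apply: (compression_eq T11E) => v.
    by rewrite pq rdotDl [X in _ + X]rdotC valH1 addr0.
  have -> : T21 a = q.
    by apply: (compression_eq T21E) => v; rewrite pq rdotDl valH1 add0r.
  by rewrite linearD pq Uval addrA.
Qed.
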